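(* Let $\beta,\gamma>1$ be real numbers and suppose $$\gamma-1=\frac mn(\beta-1),\qquad m,n\in\mathbb N,\quad \gcd(m,n)=1.$$ Then $$\operatorname{Fix}(T_\beta)\cap\operatorname{Fix}(T_\gamma)=\left\{\frac{n\ell}{\beta-1}:\ell\in\mathbb Z_{\ge 0},\ n\ell<\beta-1\right\}.$$ Every probability measure supported on this finite set is invariant under both $T_\beta$ and $T_\gamma$. The set contains a nonzero point if and only if $\beta>n+1$.
   Context: $X=[0,1)$ and $\mathbb N=\{1,2,\ldots\}$. For a real number $b>1$, the beta-transformation $T_b:X\to X$ is $T_b(x)=bx-\lfloor bx\rfloor$, and $\operatorname{Fix}(T_b)=\{x\in X:T_b(x)=x\}$. A Borel measure $\mu$ on $X$ is invariant under $F:X\to X$ if $F_*\mu=\mu$, where $F_*\mu(E)=\mu(F^{-1}E)$. *)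

(* Defs.v *)
From HB Require Import structures.
From mathcomp Require Import all_boot all_order all_algebra.
From mathcomp Require Import all_classical all_reals all_analysis.
Set Implicit Arguments.
Unset Strict Implicit.
Unset Printing Implicit Defensive.
Import Order.TTheory GRing.Theory Num.Theory.
Import numFieldNormedType.Exports.
Local Open Scope classical_set_scope.
Local Open Scope ring_scope.

Definition X (R : realType) : Type := set_type (`[0, 1[%classic : set R).

(* [set_type] carries the subspace topology inherited from [R]. *)
HB.instance Definition _ (R : realType) :=
  Topological.copy (X R) (set_type (`[0, 1[%classic : set R)).

Lemma X0_subproof (R : realType) : (0 : R) \in (`[0, 1[%classic : set R).
Proof. by rewrite inE /= in_itv /= lexx ltr01. Qed.

(* Measurable types are pointed in this library. *)
HB.instance Definition _ (R : realType) :=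
  isPointed.Build (X R) (exist _ (0 : R) (X0_subproof R)).

(* The Borel sigma-algebra of [X], generated by its open sets. *)
HB.instance Definition _ (R : realType) :=
  @isMeasurable.Build (sigma_display (@open (X R))) (X R) <<s @open (X R) >>
    (@sigma_algebra0 _ setT (@open (X R))) (@sigma_algebraC _ (@open (X R)))
    (@sigma_algebra_bigcup _ setT (@open (X R))).

Lemma beta_map_subproof (R : realType) (b : R) (x : X R) :
  b * set_val x - (Num.floor (b * set_val x))%:~R
    \in (`[0, 1[%classic : set R).
Proof.
rewrite inE /= in_itv /= subr_ge0 floor_le /=.
by rewrite ltrBlDl -[X in _ + X]/(1%:~R) -intrD floorD1_gt.
Qed.

Definition beta_map (R : realType) (b : R) (x : X R) : X R :=
  exist _ (b * set_val x - (Num.floor (b * set_val x))%:~R)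
    (beta_map_subproof b x).

Definition Fix (T : Type) (F : T -> T) : set T := [set x | F x = x].

Definition invariant_measure (d : measure_display) (T : measurableType d)
    (R : realType) (mu : {measure set T -> \bar R}) (F : T -> T) : Prop :=
  forall E : set T, measurable E -> pushforward mu F E = mu E.

Definition supported_on (d : measure_display) (T : measurableType d)
    (R : realType) (mu : {measure set T -> \bar R}) (A : set T) : Prop :=
  mu (~` A) = 0%E.

(* As a set of reals, so that equating it with a set of points of [X] also
   asserts that it lies in [0, 1[. *)
Definition grid (R : realType) (beta : R) (n : nat) : set R :=
  [set n%:R * l%:R / (beta - 1) | l in [set l : nat | n%:R * l%:R < beta - 1]].

(* Main.v *)
Require Import Defs.
From HB Require Import structures.
From mathcomp Require Import all_boot all_order all_algebra.
From mathcomp Require Import all_classical all_reals all_analysis.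
From mathcomp Require Import measurable_realfun.
Set Implicit Arguments.
Unset Strict Implicit.
Unset Printing Implicit Defensive.
Import Order.TTheory GRing.Theory Num.Theory.
Import numFieldNormedType.Exports.
Local Open Scope classical_set_scope.
Local Open Scope ring_scope.

(** A point [x] of [0,1) is fixed by [beta_map b] exactly when [(b - 1) * x] is an integer
    ([Fix_beta_mapP]). Being fixed by both maps is thus a pair of integrality conditions tied by the
    ratio m/n, and coprimality turns them into divisibility of [(beta - 1) * x] by n
    ([common_Fix_grid]). Invariance uses only that both maps are measurable and restrict to the
    identity on the support ([fixed_support_invariant]). *)

Lemma set_valX_itv (R : realType) (x : X R) : 0 <= set_val x < 1.
Proof. by have := set_valP x; rewrite /= in_itv. Qed.

(** The equation b x - floor(b x) = x says that (b - 1) x equals the floor; conversely, if (b - 1) x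
    = k then b x = k + x with 0 <= x < 1, which forces the floor to be k. *)
Lemma Fix_beta_mapP (R : realType) (b : R) (x : X R) :
  Fix (beta_map b) x <-> (b - 1) * set_val x \is a Num.int.
Proof.
split => [/(congr1 set_val)/=|/intrP[k xk]].
  rewrite !set_valE/= => e.
  rewrite mulrBl mul1r -[X in _ - X]e opprB addrC subrK.
  exact: intr_int.
have bxE : b * set_val x = set_val x + k%:~R.
  by rewrite -xk mulrBl mul1r addrC subrK.
apply: val_inj => /=.
have -> : Num.floor (b * set_val x) = k.
  apply/eqP; rewrite floor_eq bxE intrD1 [_ + 1]addrC.
  by have /andP[x0 x1] := set_valX_itv x; rewrite lerDr x0 ltrD2r.
by rewrite bxE addrK.
Qed.

Lemma measurable_set_valX (R : realType) :
  measurable_fun [set: X R] (set_val : X R -> R).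
Proof.
apply: (measurability _ (RGenOpens.measurableE R)) => _ [_ [a [b ->] <-]].
rewrite setTI; apply: sub_sigma_algebra.
exists `]a, b[%classic => //; exact: interval_open.
Qed.

Lemma measurable_floor (R : realType) :
  measurable_fun [set: R] (fun x : R => (Num.floor x)%:~R : R).
Proof.
by apply: nondecreasing_measurable => // x y xy; rewrite ler_int le_floor.
Qed.

Lemma measurable_beta_map (R : realType) (b : R) :
  measurable_fun [set: X R] (beta_map b).
Proof.
have mbx : measurable_fun [set: X R] (fun x : X R => b * set_val x).
  by apply: measurable_funM => //; exact: measurable_set_valX.
have mval : measurable_fun [set: X R] (set_val \o beta_map b : X R -> R).
  apply: measurable_funB => //.
  by apply: (measurableT_comp (@measurable_floor R)).
(* An open set of [X R] is the trace of an open [V] of the line, so its preimage under [beta_map b]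
   is that of [V] under the real-valued map [mval]. *)
apply: (measurability _ (erefl : @measurable _ (X R) = <<s @open (X R) >>)).
move=> _ [_ [V oV <-] <-].
rewrite -comp_preimage; apply: mval => //; exact: open_measurable.
Qed.

Lemma fixed_support_invariant (d : measure_display) (T : measurableType d)
    (R : realType) (mu : {measure set T -> \bar R}) (F : T -> T) (A : set T) :
  measurable_fun setT F -> measurable A -> A `<=` Fix F ->
  supported_on mu A -> invariant_measure mu F.
Proof.
move=> mF mA AF muA E mE.
have mFE : measurable (F @^-1` E) by rewrite -[F @^-1` E]setTI; exact: mF.
have muI B : measurable B -> mu B = mu (B `&` A).
  move=> mB; rewrite (measureDI mu mB mA) [X in (X + _)%E](_ : _ = 0%E) ?add0e//.
  apply: (@subset_measure0 _ _ _ mu _ (~` A)) => //.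
  - exact: measurableD.
  - exact: measurableC.
rewrite /pushforward (muI _ mFE) [RHS](muI _ mE); congr (mu _).
by apply/seteqP; split=> x /= [] + Ax; rewrite (AF _ Ax).
Qed.

(** As n >= 1, every admissible index satisfies l <= n l < beta - 1, so the indices are bounded. *)
Lemma finite_grid (R : realType) (beta : R) (n : nat) :
  (0 < n)%N -> finite_set (grid beta n).
Proof.
move=> n0; apply: finite_image.
apply: (@sub_finite_set _ _ `I_(Num.truncn (beta - 1)).+1); last exact: finite_II.
move=> l /= nl; rewrite -(ltr_nat R).
apply: le_lt_trans (truncnS_gt _); apply: le_trans (ltW nl).
by rewrite -natrM ler_nat leq_pmull.
Qed.

(** A nonzero point has index l >= 1, whence n <= n l < beta - 1; conversely l = 1 gives a nonzero
    point as soon as it is admissible. *)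
Lemma grid_neq0P (R : realType) (beta : R) (n : nat) :
  1 < beta -> (0 < n)%N ->
  (exists2 x, grid beta n x & x != 0) <-> n%:R + 1 < beta.
Proof.
rewrite -subr_gt0 => b0 n0; rewrite -ltrBrDr; split.
  move=> [_ [l /= nl <-]]; rewrite !mulf_eq0 !negb_or => /andP[/andP[_ l0] _].
  apply: le_lt_trans nl; rewrite -natrM ler_nat leq_pmulr//.
  by rewrite lt0n -(@pnatr_eq0 R).
move=> nb; exists (n%:R * 1%:R / (beta - 1)).
  by exists 1%N; rewrite //= mulr1.
by rewrite mulr1 mulf_neq0 ?invr_eq0 ?gt_eqF ?ltr0n.
Qed.

(* If (beta - 1) x = k and (gamma - 1) x = j are both integers, then
   n j = m k, so coprimality forces n to divide k. *)
Lemma common_Fix_grid (R : realType) (beta gamma : R) (m n : nat) :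
  1 < beta -> (0 < n)%N -> coprime m n ->
  gamma - 1 = m%:R / n%:R * (beta - 1) ->
  set_val @` (Fix (beta_map beta) `&` Fix (beta_map gamma)) = grid beta n.
Proof.
rewrite -subr_gt0 => b0 n0 cmn hrel.
have nR0 : n%:R != 0 :> R by rewrite pnatr_eq0 -lt0n.
have bN0 : beta - 1 != 0 by rewrite gt_eqF.
apply/seteqP; split => [_ [x [/Fix_beta_mapP xb /Fix_beta_mapP xg] <-]|].
  have /andP[x0 x1] := set_valX_itv x.
  (* Both integers are nonnegative, so the divisibility argument can be run in [nat]. *)
  have /natrP[k kE] : (beta - 1) * set_val x \is a Num.nat.
    by rewrite natrEint xb mulr_ge0 // ltW.
  have /natrP[j jE] : (gamma - 1) * set_val x \is a Num.nat.
    rewrite natrEint xg hrel -[_ * set_val x]mulrA kE.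
    by rewrite mulr_ge0 // divr_ge0.
  have njmk : (n * j = m * k)%N.
    apply/eqP; rewrite -(eqr_nat R) !natrM -jE -kE hrel; apply/eqP.
    by rewrite !mulrA [n%:R * _]mulrC mulfK.
  have /dvdnP[l kl] : (n %| k)%N.
    by rewrite -(Gauss_dvdr k (_ : coprime n m)) 1?coprime_sym// -njmk dvdn_mulr.
  have nlE : n%:R * l%:R = (beta - 1) * set_val x by rewrite kE kl -natrM mulnC.
  exists l; rewrite /= nlE ?[_ * _ / _]mulrAC ?divff ?mul1r//.
  by rewrite gtr_pMr.
(* Conversely, for x = n l / (beta - 1) the two products are the integers (beta - 1) x = n l and
   (gamma - 1) x = m l. *)
move=> _ [l /= nl <-].
have xX : n%:R * l%:R / (beta - 1) \in (`[0, 1[%classic : set R).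
  rewrite inE /= in_itv /= ltr_pdivrMr// mul1r nl andbT.
  by rewrite divr_ge0 ?mulr_ge0// ltW.
exists (SigSub xX : X R); last by rewrite set_valE.
split; apply/Fix_beta_mapP; rewrite set_valE /=.
  by rewrite mulrC divfK// -natrM natr_int.
rewrite hrel -[_ * (_ / _)]mulrA [(beta - 1) * _]mulrC divfK// mulrA divfK//.
by rewrite -natrM natr_int.
Qed.

Theorem proposition5p1 (R : realType) (beta gamma : R) (m n : nat)
    (hbeta : 1 < beta) (hgamma : 1 < gamma)
    (hm : (0 < m)%N) (hn : (0 < n)%N) (hmn : coprime m n)
    (hrel : gamma - 1 = m%:R / n%:R * (beta - 1)) :
  [/\ set_val @` (Fix (beta_map beta) `&` Fix (beta_map gamma)) = grid beta n,
      finite_set (grid beta n),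
      forall mu : probability (X R) R,
        supported_on mu (set_val @^-1` grid beta n) ->
        invariant_measure mu (beta_map beta) /\
        invariant_measure mu (beta_map gamma)
    & (exists2 x : R, grid beta n x & x != 0) <-> n%:R + 1 < beta].
Proof.
have fixE := common_Fix_grid hbeta hn hmn hrel.
split; [exact: fixE|exact: finite_grid| |exact: grid_neq0P].
move=> mu supp.
have mgrid : measurable (set_val @^-1` grid beta n : set (X R)).
  rewrite -[X in measurable X]setTI; apply: measurable_set_valX => //.
  apply: countable_measurable; first by move=> ?; exact: measurable_set1.
  exact/finite_set_countable/finite_grid.
(* Injectivity of [set_val] carries the equality of sets of reals back to points of [X R]. *)
have gridF : set_val @^-1` grid beta n `<=`
    Fix (beta_map beta) `&` Fix (beta_map gamma).
  by move=> x /=; rewrite -fixE => -[y fixy /val_inj <-].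
split; apply: (fixed_support_invariant _ mgrid _ supp).
- exact: measurable_beta_map.
- by move=> x /gridF[].
- exact: measurable_beta_map.
- by move=> x /gridF[].
Qed.
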